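(* Let $\mathcal A$ be an almost disjoint family on an infinite countable set. If $\mathcal A$ is semi-proximal, then $\mathcal A$ is nowhere MAD.
   Context: An almost disjoint family on an infinite countable set $N$ is a collection $\mathcal A$ of infinite subsets of $N$ any two distinct members of which have finite intersection. Its $\Psi$-space $\Psi(\mathcal A)$ is the (disjoint) union $N\cup\mathcal A$, topologized so that $N$ is open and discrete and, for $a\in\mathcal A$, the sets $\{a\}\cup (a\setminus F)$, $F\subseteq N$ finite, form a local basis at $a$. Let $\mathcal I(\mathcal A)=\{X\subseteq N : \text{there is a finite } \mathcal A'\subseteq\mathcal A \text{ with } X\setminus\bigcup\mathcal A' \text{ finite}\}$ and $\mathcal I^+(\mathcal A)=\mathcal P(N)\setminus\mathcal I(\mathcal A)$. $\mathcal A$ is nowhere MAD if for every $X\in\mathcal I^+(\mathcal A)$ there is an infinite $B\subseteq X$ such that $a\cap B$ is finite for every $a\in\mathcal A$. Proximal game on a uniform space $(Z,\mathbb U)$: for an entourage $U$ write $U[x]=\{y\in Z : (x,y)\in U\}$. At inning $0$ Player I plays $U_0\in\mathbb U$ and Player II plays $x_0\in Z$; at inning $n+1$ Player I plays $U_{n+1}\in\mathbb U$ with $U_{n+1}\subseteq U_n$ and Player II plays $x_{n+1}\in U_n[x_n]$. Player I wins if $(x_n)_{n\in\omega}$ converges in the topology induced by $\mathbb U$ or $\bigcap_{n\in\omega}U_n[x_n]=\emptyset$; otherwise Player II wins. $(Z,\mathbb U)$ is semi-proximal if Player II has no winning strategy. A strategy for Player II assigns a legal move to each finite sequence of moves of Player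 I; it is winning if Player II wins every run following it. A topological space is semi-proximal if there is a uniformity $\mathbb U$ inducing its topology for which the uniform space is semi-proximal. An almost disjoint family is called semi-proximal if its $\Psi$-space is. *)

(* Defs.v *)
From HB Require Import structures.
From mathcomp Require Import all_boot all_classical.
From mathcomp Require Import topology.

Set Implicit Arguments.
Unset Strict Implicit.
Unset Printing Implicit Defensive.

Local Open Scope classical_set_scope.

Definition almost_disjoint (N : Type) (A : set (set N)) : Prop :=
  (forall a, A a -> infinite_set a) /\
  (forall a b, A a -> A b -> a <> b -> finite_set (a `&` b)).

Definition ad_ideal (N : Type) (A : set (set N)) : set (set N) :=
  [set X | exists A' : set (set N),
     [/\ finite_set A', A' `<=` A & finite_set (X `\` \bigcup_(a in A') a)]].

Definition nowhere_MAD (N : Type) (A : set (set N)) : Prop :=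
  forall X, ~ ad_ideal A X ->
    exists B, [/\ infinite_set B, B `<=` X &
                  forall a, A a -> finite_set (a `&` B)].

Definition Psi (N : Type) (A : set (set N)) : Type := (N + set_type A)%type.

Section PsiTopology.
Context (N : Type) (A : set (set N)).

HB.instance Definition _ := gen_eqMixin (Psi A).
HB.instance Definition _ := gen_choiceMixin (Psi A).

Definition Psi_basic (a : set_type A) (F : set N) : set (Psi A) :=
  [set z : Psi A | match z with
                   | inl n => (val a `\` F) n
                   | inr b => b = a
                   end].

Definition Psi_nbhs (z : Psi A) : set_system (Psi A) :=
  match z with
  | inl _ => principal_filter z
  | inr a => filter_from finite_set (Psi_basic a)
  end.

HB.instance Definition _ := hasNbhs.Build (Psi A) Psi_nbhs.

Let Psi_nbhs_filter (z : Psi A) : ProperFilter (nbhs z).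
Proof.
case: z => [n|a]; first exact: principal_filter_proper.
apply: filter_from_proper; last first.
  by move=> F _; exists (inr a).
apply: filter_from_filter; first by exists set0; exact: finite_set0.
move=> F G finF finG; exists (F `|` G); first by rewrite /= finite_setU.
by move=> [n [an /not_orP[nF nG]]|b ->]; split.
Qed.

Let Psi_nbhs_singleton (z : Psi A) (P : set (Psi A)) : nbhs z P -> P z.
Proof. by case: z => [n|a]; [move=> /principal_filterP|move=> [F _]; exact]. Qed.

Let Psi_nbhs_nbhs (z : Psi A) (P : set (Psi A)) :
  nbhs z P -> nbhs z (nbhs^~ P).
Proof.
case: z => [n|a].
  by move=> nP; apply/principal_filterP.
move=> [F finF FP]; exists F => // -[n Fn|b ->]; last by exists F.
by apply/principal_filterP; exact: FP.
Qed.

HB.instance Definition _ := Nbhs_isNbhsTopological.Build (Psi A)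
  Psi_nbhs_filter Psi_nbhs_singleton Psi_nbhs_nbhs.

End PsiTopology.

Section ProximalGame.
Context (Z : uniformType).
Implicit Types (U : nat -> set (Z * Z)) (x : nat -> Z).

(* Only the values U 0, ..., U n matter. *)
Definition legal_upto U (n : nat) : Prop :=
  (forall i, (i <= n)%N -> entourage (U i)) /\
  (forall i, (i < n)%N -> U i.+1 `<=` U i).

(* A strategy of Player II reads the sequence [:: U 0; ...; U n] and answers
   x n. Player II's own earlier moves need not be part of its input since the
   strategy determines them. *)
Definition strategy := seq (set (Z * Z)) -> Z.

Definition answer (sigma : strategy) U (n : nat) : Z := sigma (mkseq U n.+1).

(* x 0 is unconstrained, and U 0 (not U 1) constrains x 1. *)
Definition legal_strategy (sigma : strategy) : Prop :=
  forall U n, legal_upto U n.+1 ->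
    xsection (U n) (answer sigma U n) (answer sigma U n.+1).

Definition playerI_wins U x : Prop :=
  (exists l : Z, x @ \oo --> l) \/ \bigcap_n xsection (U n) (x n) = set0.

Definition winning_strategy (sigma : strategy) : Prop :=
  legal_strategy sigma /\
  forall U, (forall n, legal_upto U n) -> ~ playerI_wins U (answer sigma U).

Definition semi_proximal_uniform : Prop :=
  ~ exists sigma : strategy, winning_strategy sigma.

End ProximalGame.

(* The mixin record ranges over the uniformities whose induced neighbourhood
   filters are the given ones of X, so m is a uniformity inducing the topology
   of X. *)
Definition semi_proximal (X : topologicalType) : Prop :=
  exists m : Nbhs_isUniform_mixin X,
    semi_proximal_uniform (HB.pack_for uniformType X m).

Definition semi_proximal_family (N : Type) (A : set (set N)) : Prop :=
  semi_proximal (Psi A).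

(* Main.v *)
Require Import Defs.
From HB Require Import structures.
From mathcomp Require Import all_boot all_classical.
From mathcomp Require Import topology.

Local Open Scope classical_set_scope.

(* Suppose that X is not in the ideal but every infinite B included in X has
   infinite intersection with some member of A.  Call J included in X large
   when infinitely many members of A meet it in an infinite set.  X is large,
   and for every entourage U a large J has a large subset of the form
   J `&` U[x]: otherwise J contains a sequence of pairwise U-apart points, yet
   infinitely many of them lie in a single a, to which they converge.  Player II maintains
   decreasing large sets J_n whose closures are U_n-small and plays points a_n
   of A in the closure of J_n with a_(n+1) <> a_n.  As the points of A are
   not limits of one another, (a_n) diverges; an infinite pseudo-intersection of
   the J_n accumulates at some a in A, which lies in every U_n[a_n]. *)

(** Each choice sees the finite set of earlier values and avoids it, whence injectivity; [P] may
    also depend on that set. This builds both pseudo-intersections and sequences of pairwise apart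
    points. *)
Lemma injective_dependent_sequence (T : Type) (P : nat -> set T -> T -> Prop) :
  (forall n S, finite_set S -> exists y, P n S y /\ ~ S y) ->
  exists f : nat -> T, injective f /\ forall n, P n (f @` `I_n) (f n).
Proof.
move=> Pex.
have /choice[g gP] : forall nS, exists y,
    finite_set nS.2 -> P nS.1 nS.2 y /\ ~ nS.2 y.
  move=> [n S]; have [finS|infS] := pselect (finite_set S).
    by have [y Py] := Pex n S finS; exists y.
  by have [y _] := Pex n set0 (finite_set0 _); exists y => /infS.
pose s := fix s n := if n is k.+1 then s k `|` [set g (k, s k)] else set0.
pose f n := g (n, s n).
have sE n : s n = f @` `I_n.
  elim: n => [|n IHn] /=; first by rewrite II0 image_set0.
  by rewrite IIS image_setU image_set1 -IHn.
have sfin n : finite_set (s n) by rewrite sE; exact/finite_image/finite_II.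
exists f; split; last by move=> n; rewrite -sE; have [] := gP (n, s n) (sfin n).
have lt_neq i j : (i < j)%N -> f i <> f j.
  move=> ij fij; have [_] := gP (j, s j) (sfin j).
  by apply; rewrite -/(f j) /= sE; exists i.
by move=> i j fij; case: (ltngtP i j) => // /lt_neq; rewrite fij.
Qed.

Lemma injective_infinite_range (T : Type) (f : nat -> T) :
  injective f -> infinite_set (range f).
Proof.
move=> finj finf; apply: infinite_nat.
rewrite -(_ : f @^-1` range f = setT); last first.
  by apply/seteqP; split=> // n _; exists n.
by apply: finite_preimage finf => i j _ _; exact: finj.
Qed.

Section LimitPoints.
Context (N : Type) (A : set (set N)).
Implicit Types (J K X : set N) (a b : set_type A).

(** Neighbourhoods of [inr a] contain almost all of [a], so these are the points of [A] in the
    closure of [J] in the Psi-space. *)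
Definition limit_points J : set (set_type A) :=
  [set a | infinite_set (val a `&` J)].

Definition large J := infinite_set (limit_points J).

Lemma limit_points_sub J K : J `<=` K -> limit_points J `<=` limit_points K.
Proof. by move=> JK a; apply: sub_infinite_set; exact: setIS. Qed.

(** A limit point of [J] is one of some piece [J] [&] [B x] or of the remainder, and the finitely
    many pieces have only finitely many limit points together. *)
Lemma large_remainder J (F : set N) (B : N -> set N) :
  finite_set F -> large J -> (forall x, ~ large (J `&` B x)) ->
  large (J `\` \bigcup_(x in F) B x).
Proof.
move=> finF Jlarge Bsmall finD; apply: Jlarge.
apply: (@sub_finite_set _ _ (\bigcup_(x in F) limit_points (J `&` B x) `|`
    limit_points (J `\` \bigcup_(x in F) B x))); last first.
  rewrite finite_setU; split => //.
  by apply: bigcup_finite => // x _; have /contrapT := Bsmall x.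
move=> a aJ; apply: contrapT => /not_orP[anB /contrapT anD].
apply: aJ; apply: (@sub_finite_set _ _ (\bigcup_(x in F) (val a `&` (J `&` B x))
    `|` (val a `&` (J `\` \bigcup_(x in F) B x)))).
  move=> n [an Jn]; have [[x Fx Bxn]|nB] := pselect ((\bigcup_(x in F) B x) n).
    by left; exists x.
  by right.
rewrite finite_setU; split => //; apply: bigcup_finite => // x Fx.
by apply: contrapT => aB; apply: anB; exists x.
Qed.

Section LocallyMAD.
Context (X : set N).
(** [X] violates the conclusion of nowhere MAD; whether it lies in the ideal is left open. *)
Hypothesis XMAD : forall B, infinite_set B -> B `<=` X ->
  exists a, limit_points B a.

(** If [X] had finitely many limit points, removing them would leave an infinite set; a limit point
    of it would be one of [X], hence already removed. *)
Lemma not_ideal_large : ~ ad_ideal A X -> large X.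
Proof.
move=> XnI finX; have [] := XMAD (X `\` \bigcup_(a in limit_points X) val a).
- move=> finD; apply: XnI; exists (val @` limit_points X); split => //.
  + exact: finite_image.
  + by move=> _ [a _ <-]; exact: set_valP.
  + by rewrite bigcup_image.
- by move=> n [].
- move=> a aD; suff aX : limit_points X a.
    apply: aD; rewrite (_ : _ `&` _ = set0); first exact: finite_set0.
    by apply/seteqP; split=> // n [an [_]]; case; exists a.
  by apply: limit_points_sub aD => n [].
Qed.

Lemma large_infinite J : large J -> infinite_set J.
Proof.
move=> /infinite_setN0[a aJ] finJ; apply: aJ; exact: finite_setIr.
Qed.

Lemma limit_points_decreasing (J : nat -> set N) :
  (forall n, large (J n)) -> (forall n, J n `<=` X) ->
  (forall n, J n.+1 `<=` J n) -> exists a, forall n, limit_points (J n) a.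
Proof.
move=> Jlarge JX Jdecr.
have Jle m n : (m <= n)%N -> J n `<=` J m.
  elim: n => [|n IHn]; first by rewrite leqn0 => /eqP->.
  rewrite leq_eqVlt => /predU1P[->//|/IHn JnJm].
  by apply: subset_trans JnJm; exact: Jdecr.
have [|y [yinj yJ]] := @injective_dependent_sequence N (fun n _ => J n).
  move=> n S finS; have infJ := large_infinite _ (Jlarge n).
  by have [y] := infinite_setN0 (infinite_setD infJ finS); exists y.
have [||a ay] := XMAD (range y).
- exact: injective_infinite_range.
- by move=> _ [n _ <-]; exact/JX/yJ.
exists a => n; apply: contrapT => /contrapT aJ; apply: ay.
(* Only the first [n] terms of [y] can lie outside [J n]. *)
apply: (@sub_finite_set _ _ ((val a `&` J n) `|` (y @` `I_n))).
  move=> z [az [k _ yk]]; have [kn|nk] := ltnP k n; first by right; exists k.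
  by left; split=> //; rewrite -yk; exact/(Jle _ _ nk)/yJ.
by rewrite finite_setU; split=> //; exact/finite_image/finite_II.
Qed.

Lemma Psi_nbhs_limit_point a J (W : set (Psi A)) :
  nbhs (inr a : Psi A) W -> limit_points J a ->
  infinite_set (J `&` [set n | W (inl n)]).
Proof.
move=> [F finF FW] aJ finJW; apply: aJ.
apply: (@sub_finite_set _ _ (F `|` (J `&` [set n | W (inl n)]))).
  move=> n [an Jn]; have [Fn|nFn] := pselect (F n); first by left.
  by right; split=> //; apply: FW.
by rewrite finite_setU.
Qed.

Lemma Psi_not_cvg (u : nat -> set_type A) (l : Psi A) :
  (forall n, u n.+1 <> u n) -> ~ ((fun n => inr (u n) : Psi A) @ \oo --> l).
Proof.
move=> uneq ul; case: l ul => [k|a] ul.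
  have /ul[n _] : nbhs (inl k : Psi A) [set inl k] by apply/principal_filterP.
  by move=> /(_ n (leqnn n)).
(* This neighbourhood meets [A] only in [a], so convergence would make [u] eventually constant. *)
have /ul[n _ un] : nbhs (inr a : Psi A) (Psi_basic a set0) by exists set0.
by apply: (uneq n); rewrite (un n.+1 _ : u n.+1 = a) /= ?(un n _ : u n = a) /=.
Qed.

Context (m : Nbhs_isUniform_mixin (Psi A)).
Let Z : uniformType := HB.pack_for uniformType (Psi A) m.

Lemma entourage_limit_point a J (V : set (Z * Z)) :
  entourage V -> limit_points J a ->
  infinite_set (J `&` [set n | V (inr a, inl n)]).
Proof.
move=> entV /(Psi_nbhs_limit_point _ _ _ (@nbhs_entourage Z (inr a) _ entV)).
by apply: sub_infinite_set => n [Jn Vn]; split=> //; exact: set_mem Vn.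
Qed.

Lemma large_section J (U : set (Z * Z)) : J `<=` X -> large J -> entourage U ->
  exists x : N, large (J `&` [set n | U (inl x, inl n)]).
Proof.
move=> JX Jlarge entU; apply: contrapT => /forallNP Jsmall.
pose P (n : nat) (S : set N) y := J y /\ forall x, S x -> ~ U (inl x, inl y).
have [|y [yinj yP]] := @injective_dependent_sequence N P.
  move=> n S finS.
  have /large_infinite infD := large_remainder _ _ _ finS Jlarge Jsmall.
  have [y [[Jy nU] Sy]] := infinite_setN0 (infinite_setD infD finS).
  by exists y; split=> //; split=> // x Sx Uxy; apply: nU; exists x.
have [||a ay] := XMAD (range y).
- exact: injective_infinite_range.
- by move=> _ [n _ <-]; apply: JX; have [] := yP n.
pose V := split_ent U `&` (split_ent U)^-1%relation.
have entV : entourage V.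
  by apply: filterI; [|apply: entourage_inv]; exact: entourage_split_ent.
have infV := entourage_limit_point _ _ _ entV ay.
have [_ [[i _ <-] [_ Via]]] := infinite_setN0 infV.
(* Discarding the indices up to [i] forces [i < j]: the sequence is apart only from an earlier to a
   later term. *)
have [_ [[[j _ <-] [Vaj _]] nj]] := infinite_setN0
  (infinite_setD infV (finite_image y (finite_II i.+1))).
have ij : (i < j)%N by rewrite ltnNge; apply/negP => ji; apply: nj; exists j.
have [_ /(_ (y i))] := yP j; apply; first by exists i.
exact: (@entourage_split Z (inr a)).
Qed.

Lemma large_small_subset J (U : set (Z * Z)) :
  J `<=` X -> large J -> entourage U ->
  exists K, [/\ large K, K `<=` J & forall a b,
    limit_points K a -> limit_points K b -> U (inr a, inr b)].
Proof.
move=> JX Jlarge entU.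
have entU1 := entourage_split_ent entU.
(* Two halvings: [W] links [x] to a limit point through a nearby [n], giving [V]; [V] links two
   limit points through [x], giving [U]. *)
pose V := split_ent U `&` (split_ent U)^-1%relation.
have entV : entourage V by apply: filterI => //; exact: entourage_inv.
pose W := split_ent V `&` (split_ent V)^-1%relation.
have entW : entourage W.
  by apply: filterI; [|apply: entourage_inv]; exact: entourage_split_ent.
have [x Kx] := large_section _ _ JX Jlarge entW.
pose K := J `&` [set n | W (inl x, inl n)].
have KV c : limit_points K c -> V (inl x, inr c).
  move=> /(entourage_limit_point _ _ _ entW).
  move=> /infinite_setN0[n [[_ [Wxn _]] [_ Wnc]]].
  exact: (@entourage_split Z (inl n)).
exists K; split=> //; first by move=> n [].
move=> a b /KV[_ Vax] /KV[Vxb _].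
exact: (@entourage_split Z (inl x)).
Qed.

Lemma Psi_winning_strategy : large X ->
  exists sigma : strategy Z, winning_strategy sigma.
Proof.
move=> Xlarge.
pose step_spec (Ja : set N * set_type A) (U : set (Z * Z))
    (Kb : set N * set_type A) :=
  [/\ large Kb.1, Kb.1 `<=` Ja.1, limit_points Kb.1 Kb.2, Kb.2 <> Ja.2 &
     forall a b, limit_points Kb.1 a -> limit_points Kb.1 b ->
       U (inr a, inr b)].
have /choice[step stepP] : forall JaU, exists Kb,
    JaU.1.1 `<=` X -> large JaU.1.1 -> entourage JaU.2 ->
    step_spec JaU.1 JaU.2 Kb.
  move=> [[J a] U] /=.
  have [[JX [Jl entU]]|nJ] := pselect (J `<=` X /\ large J /\ entourage U);
    last by exists (J, a) => ? ? ?; case: nJ.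
  have [K [Kl KJ KU]] := large_small_subset _ _ JX Jl entU.
  have [b [Kb ba]] := infinite_setN0 (infinite_setD Kl (finite_set1 a)).
  by exists (K, b).
have [a0 _] := infinite_setN0 Xlarge.
(* One step precedes every answer, so [a0] is never played, and the answer to [U n] is read off
   [st U n.+1], whose limit points are pairwise [U n]-close. *)
pose state := foldl (fun Ja U => step (Ja, U)) (X, a0).
pose sigma : strategy Z := fun s => inr (state s).2.
pose st U n := state (mkseq U n).
have stS U n : st U n.+1 = step (st U n, U n).
  by rewrite /st mkseqS /state foldl_rcons.
have st_inv U n : (forall i, (i < n)%N -> entourage (U i)) ->
    (st U n).1 `<=` X /\ large (st U n).1.
  elim: n => [|n IHn] entU; first by split.
  have [stX stl] := IHn (fun i ni => entU i (ltnW ni)).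
  rewrite stS; have [//|l sub _ _ _] := stepP (st U n, U n) stX stl.
    exact: entU.
  by split=> //; exact: subset_trans stX.
have stP U n : (forall i, (i <= n)%N -> entourage (U i)) ->
    step_spec (st U n) (U n) (st U n.+1).
  move=> entU; have [|stX stl] := st_inv U n.
    by move=> i /ltnW; exact: entU.
  by rewrite stS; apply: stepP => //; exact: entU.
have answerE U n : answer sigma U n = inr (st U n.+1).2 by [].
exists sigma; split=> [U n [entU _]|U Ulegal].
  apply/xsectionP; rewrite !answerE.
  have [_ _ an _ small] := stP U n (fun i ni => entU i (leqW ni)).
  (* The next answer is still a limit point of the larger set [(st U n.+1).1], where [U n]-smallness
     applies. *)
  have [_ sub aSn _ _] := stP U n.+1 entU.
  by apply: small => //; exact: limit_points_sub aSn.
have entU n : forall i, (i <= n)%N -> entourage (U i).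
  by have [] := Ulegal n.
case=> [[l]|].
  apply: Psi_not_cvg => n.
  by have [] := stP U n.+1 (entU _).
have [||n|a aJ] := limit_points_decreasing (fun n => (st U n.+1).1).
- by move=> n; have [] := stP U n (entU _).
- by move=> n; have [] := st_inv U n.+1 (fun i => entU n i).
- by have [] := stP U n.+1 (entU _).
apply/eqP/set0P; exists (inr a) => n _; apply/xsectionP; rewrite answerE.
by have [_ _ an _] := stP U n (entU _); exact.
Qed.

End LocallyMAD.
End LimitPoints.

Theorem proposition4 (N : Type)
    (Ninf : infinite_set [set: N]) (Ncount : countable [set: N])
    (A : set (set N)) (Aad : almost_disjoint A) :
  semi_proximal_family A -> nowhere_MAD A.
Proof.
move=> [m IIloses] X XnI; apply: contrapT => /forallNP noB.
have XMAD B : infinite_set B -> B `<=` X -> exists a, limit_points N A B a.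
  move=> infB BX; apply: contrapT => /forallNP nacc; apply: (noB B).
  split=> // a Aa.
  by apply: contrapT => aB; apply: (nacc (SigSub (mem_set Aa))); exact: aB.
apply: IIloses; apply: (Psi_winning_strategy N A X XMAD m).
exact: not_ideal_large.
Qed.
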